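(* Let $G=(V,E)$ be a graph. Then, for every integer $k$ with $1\le k\le |V|$, \[ \sum_{i=1}^k \lambda_i(L(G))\le |E|+k^2+15k\log k+65k . \]
   Context: Graphs are finite, simple and undirected, with non-empty vertex set. $\log$ denotes the natural logarithm. The Laplacian matrix $L(G)$ of $G=(V,E)$ is the $|V|\times|V|$ matrix with $L(G)_{u,u}=\deg(u)$, $L(G)_{u,v}=-1$ if $\{u,v\}\in E$, and $L(G)_{u,v}=0$ otherwise. For $1\le i\le |V|$, $\lambda_i(L(G))$ denotes the $i$-th largest eigenvalue of $L(G)$ (counted with multiplicity). *)

(* Defs.v *)
From HB Require Import structures.
From mathcomp Require Import all_boot all_order all_algebra.
From mathcomp Require Import polyrcf complex spectral sesquilinear.

Set Implicit Arguments.
Unset Strict Implicit.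
Unset Printing Implicit Defensive.

Import Order.TTheory GRing.Theory Num.Theory.

Local Open Scope ring_scope.

(* A finite simple graph on the vertex type V is given by its adjacency
   relation e : rel V, assumed symmetric and irreflexive where it is used. *)
Section Graph.
Variables (V : finType) (e : rel V).

Definition degree (u : V) : nat := #|[set v | e u v]|.

(* Each undirected edge {u, v} is a single two-element set. *)
Definition edges : {set {set V}} := [set [set u; v] | u in V, v in e u].

(* Rows and columns are the vertices listed by enum_val; the spectrum does not
   depend on this ordering. *)
Definition laplacian (R : pzRingType) : 'M[R]_#|V| :=
  \matrix_(i, j) (let u : V := enum_val i in let v : V := enum_val j in
    if u == v then (degree u)%:R else if e u v then -1 else 0).

End Graph.

(* The real roots of the characteristic polynomial, each repeated according to
   its multiplicity, in decreasing order.  For a symmetric matrix these are all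
   the roots (char_poly_eigenvalues), so the list has length n. *)
Definition eigenvalues (R : rcfType) (n : nat) (A : 'M[R]_n) : seq R :=
  sort >=%R
    (flatten [seq nseq (mup x (char_poly A)) x | x <- rootsR (char_poly A)]).

Lemma perm_eigenvalues (R : rcfType) n (A : 'M[R]_n) (s : seq R) :
  char_poly A = \prod_(x <- s) ('X - x%:P) -> perm_eq (eigenvalues A) s.
Proof.
move=> def_p; have p_neq0 : char_poly A != 0 by rewrite monic_neq0 ?char_poly_monic.
rewrite /eigenvalues perm_sort; apply/allP => x _ /=; apply/eqP.
rewrite -[RHS]mu_prod_XsubC -def_p count_flatten -map_comp sumnE big_map.
under eq_bigr => y _ do rewrite /= count_nseq /=.
have [px|pNx] := boolP (root (char_poly A) x).
  rewrite (bigD1_seq x) ?uniq_roots //=; last by rewrite -roots_on_rootsR ?in_itv.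
  by rewrite eqxx mul1n big1 ?addn0 // => y /negPf ->.
rewrite mupNroot // big1_seq // => y /andP[_].
by rewrite -roots_on_rootsR //=; case: eqVneq => // -> /(negP pNx).
Qed.

Lemma char_poly_eigenvalues (R : rcfType) n (A : 'M[R]_n) :
  A^T = A -> char_poly A = \prod_(x <- eigenvalues A) ('X - x%:P).
Proof.
move=> symA; set toC := complex.real_complex R.
suff [s def_p] : exists s, char_poly A = \prod_(x <- s) ('X - x%:P).
  by rewrite [RHS](perm_big _ (perm_eigenvalues def_p)).
pose B := map_mx toC A.
have realB : B \is a realmx.
  apply/mxOverP => i j; rewrite mxE; apply/complex.complex_realP; by exists (A i j).
have hermB : B \is hermsymmx.
  apply: realsym_hermsym => //; apply/is_hermitianmxP.
  by rewrite expr0 scale1r map_mx_id // map_trmx symA.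
have /orthomx_spectralP defB := hermitian_normalmx hermB.
have /mxOverP reald := hermitian_spectral_diag_real hermB.
set P := spectralmx B in defB; set d := spectral_diag B in defB reald.
have Pu : P \in unitmx by apply: spectral_unit.
have cB : char_poly B = \prod_(i < n) ('X - (d 0 i)%:P).
  have -> : char_poly B = char_poly (diag_mx d).
    rewrite /char_poly; have -> : char_poly_mx B =
      map_mx polyC (invmx P) *m char_poly_mx (diag_mx d) *m map_mx polyC P.
      rewrite /char_poly_mx mulmxBr mulmxBl -!map_mxM -defB /=; congr (_ - _).
      by rewrite mul_mx_scalar -scalemxAl -map_mxM mulVmx // map_mx1 scalemx1.
    rewrite !det_mulmx mulrAC -det_mulmx -map_mxM mulVmx // map_mx1 det1.
    by rewrite mul1r.
  rewrite char_poly_trig; last by rewrite diag_mx_is_trig.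
  by apply: eq_bigr => i _; rewrite mxE eqxx.
exists [seq complex.Re (d 0 i) | i <- enum 'I_n].
apply: (map_poly_inj toC); rewrite map_char_poly -/B cB rmorph_prod big_map.
rewrite big_enum; apply: eq_bigr => i _.
by rewrite rmorphB /= map_polyX map_polyC /= /toC complex.RRe_real.
Qed.

Lemma size_eigenvalues (R : rcfType) n (A : 'M[R]_n) :
  A^T = A -> size (eigenvalues A) = n.
Proof.
move=> /char_poly_eigenvalues /(congr1 (size \o val)) /=.
by rewrite size_char_poly size_prod_XsubC => -[].
Qed.

(* The i-th largest eigenvalue, where i counts from 1. *)
Definition lambda (R : rcfType) (n : nat) (i : nat) (A : 'M[R]_n) : R :=
  nth 0 (eigenvalues A) i.-1.

(* Main.v *)
Require Import Defs.
From mathcomp Require Import all_boot all_order all_algebra.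
From mathcomp Require Import reals exp.
From mathcomp Require Import perm complex spectral sesquilinear.
From mathcomp Require Import lra ring.

Set Implicit Arguments.
Unset Strict Implicit.
Unset Printing Implicit Defensive.

Import Order.TTheory GRing.Theory Num.Theory.

Local Open Scope ring_scope.

(* The sum of the k largest eigenvalues is tr (Q L), with Q the real part of the
   orthogonal projector onto k eigenvectors; Q is positive semidefinite of trace
   k and its columns satisfy \sum_j (Q i j)^2 <= Q i i.  Here tr (Q L) is the sum
   of p u + p v - 2 Q u v over the edges uv, where p u = Q u u.
   If every vertex set S spans at most k #|S| edges, split the term of an edge as
   1 + min (p u) (p v) + (max (p u) (p v) - 1 - 2 Q u v).  The minima add up to
   at most k (\sum_u p u) = k^2, as one sees by integrating the sparsity
   condition over the superlevel sets of p.  For the last summands, completing a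
   square shows that the positive parts of p v - 1 - 2 Q u v, summed over u,
   amount to at most p v, hence to k in total.
   In general let A maximize (edges inside A) - k #|A|.  The edges not inside A
   are sparse in the above sense, and those inside A contribute at most
   #|A| tr Q = k #|A|, since the Laplacian of a graph on A is bounded by #|A|;
   this is at most their number.  Altogether the sum is at most #|E| + k^2 + k. *)

(** * Inequalities for weighted sums over ordered pairs *)

(* This is the star bound: when Q is a projector, q its column at c and L a set
   of leaves, it says that the star with center c satisfies
   \sum_(l in L) (Q c c + Q l l - 2 * Q c l)
     <= #|L| + \sum_(l in L) Q l l + Q c c. *)
Lemma sum_pos_part_column_le (R : realFieldType) (T : finType)
    (q : T -> R) (c : T) :
  \sum_i q i ^+ 2 <= q c ->
  \sum_i Num.max 0 (q c - 1 - 2 * q i) <= q c.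
Proof.
set p := q c => sq_le; rewrite (bigD1 c) //= -/p in sq_le.
have sq_ge0 i : 0 <= q i ^+ 2 by exact: sqr_ge0.
have sumsq_ge0 : 0 <= \sum_(i | i != c) q i ^+ 2 by apply: sumr_ge0.
rewrite (bigD1 c) //= -/p.
have p_ge0 : 0 <= p by have := sqr_ge0 p; lra.
have p_le1 : p <= 1 by nra.
rewrite max_l ?add0r; last by lra.
(* The main case divides by [1 - p]; for [p = 1] the hypothesis forces [q] to vanish off [c]. *)
have [p1|p_neq1] := eqVneq p 1.
  rewrite big1 // => i iNc; rewrite max_l // p1 subrr add0r.
  have /eqP : \sum_(i | i != c) q i ^+ 2 = 0 by nra.
  rewrite psumr_eq0 // => /allP/(_ i); rewrite mem_index_enum iNc /= sqrf_eq0.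
  by move=> /(_ isT)/eqP ->; rewrite mulr0 oppr0.
have q_gt0 : 0 < 1 - p by rewrite subr_gt0 lt_neqAle p_neq1.
(* The termwise bound is [0 <= (q i + (1 - p)) ^+ 2]. Off [c] the squares add up to at most
   [p * (1 - p)]. *)
apply: (@le_trans _ _ (\sum_(i | i != c) q i ^+ 2 / (1 - p))).
  apply: ler_sum => i _; rewrite ge_max divr_ge0 ?(ltW q_gt0) //=.
  by rewrite ler_pdivlMr //; have := sqr_ge0 (q i + (1 - p)); nra.
by rewrite -mulr_suml ler_pdivrMr //; nra.
Qed.

Lemma sum_min_le (R : realFieldType) (T : finType)
    (w : T -> T -> R) (K : R) (p : T -> R) :
  (forall S : {set T},
    \sum_(i in S) \sum_(j in S) w i j <= K * #|S|%:R) ->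
  (forall i, 0 <= p i) ->
  \sum_i \sum_j w i j * Num.min (p i) (p j) <= K * \sum_i p i.
Proof.
(* Induction on the support of p, subtracting its minimum on the support. *)
move=> sparse; have [n] := ubnP #|[set i | p i != 0]|.
elim: n p => // n IHn p; set S := [set i | p i != 0] => leSn p_ge0.
have p0 i : i \notin S -> p i = 0 by rewrite inE negbK => /eqP.
have [S0|[c Sc]] := set_0Vmem S.
  have {}p0 i : p i = 0 by rewrite p0 // S0 inE.
  rewrite (eq_bigr (fun=> 0)) => [|i _].
    by rewrite [X in _ * X]big1 ?mulr0 // big1.
  by rewrite big1 // => j _; rewrite !p0 minxx mulr0.
case: (@arg_minP _ _ _ c (mem S) p Sc) => m /= Sm p_min.
change (is_true (m \in S)) in Sm.
(* [p'] cuts off the bottom layer of [p], of height [p m] over [S]. Minima drop by [p m] exactly on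
   pairs inside [S], whose weight [sparse] bounds, and [m] leaves the support. *)
pose p' i := if i \in S then p i - p m else 0.
have pE i : p i = p' i + p m * (i \in S)%:R.
  by rewrite /p'; case: ifPn => [_|/p0 ->]; rewrite (mulr1, mulr0); lra.
have p'_ge0 i : 0 <= p' i.
  by rewrite /p'; case: ifP => // /p_min; rewrite subr_ge0.
have minE i j : Num.min (p i) (p j) =
    Num.min (p' i) (p' j) + p m * ((i \in S)%:R * (j \in S)%:R).
  have := p'_ge0 i; have := p'_ge0 j; rewrite (pE i) (pE j).
  have p'0 l : l \notin S -> p' l = 0 by rewrite /p' => /negPf ->.
  have pm_ge0 := p_ge0 m.
  have [Si|/p'0 ->] := boolP (i \in S); have [Sj|/p'0 ->] := boolP (j \in S);
    rewrite !(mulr1, mulr0, addr0, mul0r, add0r) ?addr_minl // => a_ge0 b_ge0.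
  - by rewrite !min_r ?addr_ge0.
  - by rewrite !min_l ?addr_ge0.
have -> : \sum_i \sum_j w i j * Num.min (p i) (p j) =
    \sum_i \sum_j w i j * Num.min (p' i) (p' j)
    + p m * \sum_(i in S) \sum_(j in S) w i j.
  rewrite mulr_sumr [X in _ + X]big_mkcond -big_split; apply: eq_bigr => i _ /=.
  under eq_bigr => j _ do rewrite minE mulrDr.
  rewrite big_split /=; congr (_ + _); case: ifP => _; last first.
    by rewrite big1 // => j _; rewrite mul0r !mulr0.
  rewrite mulr_sumr [RHS]big_mkcond; apply: eq_bigr => j _.
  by case: ifP => _; rewrite ?mul1r ?mulr0 // mulr1 mulrC.
have -> : \sum_i p i = \sum_i p' i + p m * #|S|%:R.
  under eq_bigr do rewrite pE.
  rewrite big_split -mulr_sumr /=; congr (_ + _ * _).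
  by rewrite -sum1_card natr_sum [RHS]big_mkcond; apply: eq_bigr => i _; case: ifP.
rewrite mulrDr lerD //; last first.
  by rewrite mulrCA ler_wpM2l ?sparse.
apply: IHn => //; rewrite -ltnS; apply: leq_trans leSn; rewrite ltnS.
apply: proper_card; apply/properP; split.
  by apply/subsetP => i; rewrite inE /p'; case: ifP => //; rewrite eqxx.
by exists m => //; rewrite inE /p' Sm subrr eqxx.
Qed.

(** The summands are values of the form [Q] at differences of unit vectors, hence nonnegative, so
    all weights may be raised to 1. For the resulting complete graph on [S], what is subtracted from
    [2 * #|S|] times the trace over [S] is twice the form at the indicator of [S]. *)
Lemma sum_dist_le (R : realFieldType) (T : finType)
    (w Q : T -> T -> R) (S : {set T}) :
  (forall i j, 0 <= w i j <= 1) ->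
  (forall i j, Q i j = Q j i) ->
  (forall x : T -> R, 0 <= \sum_i \sum_j x i * x j * Q i j) ->
  \sum_(i in S) \sum_(j in S) w i j * (Q i i + Q j j - 2 * Q i j) <=
    2 * #|S|%:R * \sum_i Q i i.
Proof.
move=> w01 Qsym psd.
have diag_ge0 i : 0 <= Q i i.
  have := psd (fun l => (l == i)%:R).
  rewrite (bigD1 i) //= [X in _ + X]big1 => [|j /negPf jNi]; last first.
    by rewrite big1 // => l _; rewrite jNi !mul0r.
  rewrite (bigD1 i) //= big1 => [|l /negPf lNi]; last by rewrite lNi mulr0 mul0r.
  by rewrite eqxx !mul1r !addr0.
have dist_ge0 i j : 0 <= Q i i + Q j j - 2 * Q i j.
  have [->|iNj] := eqVneq i j; first lra.
  have jNi : j != i by rewrite eq_sym.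
  have sumE (F : T -> R) :
      \sum_l ((l == i)%:R - (l == j)%:R) * F l = F i - F j.
    rewrite (bigD1 i) // (bigD1 j) //= !eqxx (negPf iNj) (negPf jNi) big1 => [|l].
      by rewrite addr0 subr0 sub0r mul1r mulN1r.
    by case/andP=> /negPf -> /negPf ->; rewrite subr0 mul0r.
  have := psd (fun l => (l == i)%:R - (l == j)%:R).
  under eq_bigr => l _.
    under eq_bigr do rewrite -mulrA.
    rewrite -mulr_sumr sumE.
    over.
  by rewrite sumE (Qsym j i); lra.
have Q_ge0 : 0 <= \sum_(i in S) \sum_(j in S) Q i j.
  have := psd (fun l => (l \in S)%:R); congr (0 <= _).
  rewrite [RHS]big_mkcond; apply: eq_bigr => i _ /=; case: ifP => _.
    rewrite [RHS]big_mkcond; apply: eq_bigr => j _.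
    by case: ifP => _; rewrite !mul1r // mul0r.
  by rewrite big1 // => j _; rewrite !mul0r.
have sumSS : \sum_(i in S) \sum_(j in S) (Q i i + Q j j - 2 * Q i j) =
    2 * #|S|%:R * \sum_(i in S) Q i i - 2 * \sum_(i in S) \sum_(j in S) Q i j.
  under eq_bigr => i _.
    rewrite sumrB big_split /= sumr_const -mulr_sumr.
    over.
  rewrite sumrB big_split /= sumr_const -mulr_sumr sumrMnl.
  by rewrite -[_ *+ #|S|]mulr_natl; lra.
apply: (@le_trans _ _ (\sum_(i in S) \sum_(j in S) (Q i i + Q j j - 2 * Q i j))).
  apply: ler_sum => i _; apply: ler_sum => j _; rewrite ler_piMl //.
  by case/andP: (w01 i j).
rewrite sumSS.
apply: (@le_trans _ _ (2 * #|S|%:R * \sum_(i in S) Q i i)); first lra.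
rewrite ler_wpM2l ?mulr_ge0 // big_mkcond.
by apply: ler_sum => i _; case: ifP.
Qed.

(** For an adjacency relation [w] every edge occurs in both orders, so this is twice the bound for
    [tr (Q L)]. *)
Lemma weighted_dist_le (R : realFieldType) (T : finType) (w Q : T -> T -> R) :
  (forall i j, 0 <= w i j <= 1) ->
  (forall i j, Q i j = Q j i) ->
  (forall x : T -> R, 0 <= \sum_i \sum_j x i * x j * Q i j) ->
  (forall i, \sum_j Q i j ^+ 2 <= Q i i) ->
  \sum_i \sum_j w i j * (Q i i + Q j j - 2 * Q i j) <=
    \sum_i \sum_j w i j + 2 * (\sum_i Q i i) ^+ 2 + 2 * \sum_i Q i i.
Proof.
move=> w01 Qsym psd sq_le; set t := \sum_i Q i i.
have diag_ge0 i : 0 <= Q i i.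
  by apply: le_trans (sq_le i); apply: sumr_ge0 => j _; exact: sqr_ge0.
(* The set A of largest excess is bounded by sum_dist_le; by its maximality the
   pairs outside A satisfy the sparsity condition of sum_min_le. *)
pose excess (S : {set T}) : R :=
  \sum_(i in S) \sum_(j in S) w i j - 2 * t * #|S|%:R.
case: (@Order.TotalTheory.arg_maxP _ _ _ set0 predT excess isT) => /= A _ A_max.
have {}A_max S : excess S <= excess A by exact: A_max.
have excess_ge0 : 0 <= excess A.
  by apply: le_trans (A_max set0); rewrite /excess big_set0 cards0 mulr0 subr0.
pose w' i j := if (i \in A) && (j \in A) then 0 else w i j.
have w_ge0 i j : 0 <= w i j by case/andP: (w01 i j).
have w'_ge0 i j : 0 <= w' i j by rewrite /w'; case: ifP.
have w'_le1 i j : w' i j <= 1 by rewrite /w'; case: ifP => // _; case/andP: (w01 i j).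
have split_w (S : {set T}) (F : T -> T -> R) : A \subset S ->
    \sum_(i in S) \sum_(j in S) w i j * F i j =
    \sum_(i in A) \sum_(j in A) w i j * F i j
    + \sum_(i in S) \sum_(j in S) w' i j * F i j.
  move=> /subsetP AS.
  have -> : \sum_(i in A) \sum_(j in A) w i j * F i j =
      \sum_(i in S) \sum_(j in S) (w i j - w' i j) * F i j.
    rewrite [LHS]big_mkcond [RHS]big_mkcond; apply: eq_bigr => i _ /=.
    rewrite /w'; case: (boolP (i \in A)) => [/AS ->|_] /=; last first.
      by case: ifP => // _; rewrite big1 // => j _; rewrite subrr mul0r.
    rewrite [LHS]big_mkcond [RHS]big_mkcond; apply: eq_bigr => j _ /=.
    case: (boolP (j \in A)) => [/AS ->|_] /=; first by rewrite subr0.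
    by rewrite subrr mul0r if_same.
  rewrite -big_split; apply: eq_bigr => i _ /=.
  by rewrite -big_split; apply: eq_bigr => j _ /=; rewrite -mulrDl subrK.
(* Enlarging [A] to [S :|: A] gains at least the [w'] weight of [S] and costs at most
   [2 * t * #|S|]; by maximality the gain cannot exceed the cost. *)
have sparse (S : {set T}) : \sum_(i in S) \sum_(j in S) w' i j <= 2 * t * #|S|%:R.
  have := A_max (S :|: A); rewrite /excess.
  have := split_w (S :|: A) (fun=> fun=> 1) (subsetUr S A).
  under eq_bigr do under eq_bigr do rewrite mulr1.
  under [X in _ = X + _]eq_bigr do under eq_bigr do rewrite mulr1.
  under [X in _ = _ + X]eq_bigr do under eq_bigr do rewrite mulr1.
  move=> -> maxA.
  have cardU : 2 * t * #|S :|: A|%:R <= 2 * t * #|S|%:R + 2 * t * #|A|%:R.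
    rewrite -mulrDr -natrD ler_wpM2l ?ler_nat ?leq_card_setU //.
    by rewrite mulr_ge0 // sumr_ge0.
  suff : \sum_(i in S) \sum_(j in S) w' i j <=
      \sum_(i in S :|: A) \sum_(j in S :|: A) w' i j by lra.
  rewrite [leLHS]big_mkcond [leRHS]big_mkcond; apply: ler_sum => i _.
  rewrite inE; case: (i \in S) => /=; last by case: ifP => // _; apply: sumr_ge0.
  rewrite [leLHS]big_mkcond [leRHS]big_mkcond; apply: ler_sum => j _.
  by rewrite inE; case: (j \in S) => //=; case: ifP.
have sumT (F : T -> T -> R) :
    \sum_i \sum_j F i j = \sum_(i in [set: T]) \sum_(j in [set: T]) F i j.
  apply: eq_big => i; first by rewrite inE.
  by move=> _; apply: eq_bigl => j; rewrite inE.
have tw1 : \sum_i \sum_j w i j =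
    \sum_(i in A) \sum_(j in A) w i j + \sum_i \sum_j w' i j.
  have := split_w setT (fun=> fun=> 1) (subsetT A); rewrite -!sumT.
  under eq_bigr do under eq_bigr do rewrite mulr1.
  under [X in _ = X + _]eq_bigr do under eq_bigr do rewrite mulr1.
  by under [X in _ = _ + X]eq_bigr do under eq_bigr do rewrite mulr1.
rewrite sumT split_w ?subsetT // -!sumT tw1.
(* The resulting bound [2 * #|A| * t] is at most the weight inside [A], by [excess_ge0]. *)
have insideA := sum_dist_le A w01 Qsym psd; rewrite -/t in insideA.
suff : \sum_i \sum_j w' i j * (Q i i + Q j j - 2 * Q i j) <=
    \sum_i \sum_j w' i j + 2 * t ^+ 2 + 2 * t.
  by rewrite /excess in excess_ge0; lra.
have min_le := sum_min_le sparse diag_ge0.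
(* Either endpoint may carry the maximum, so the remainder [h] is bounded by [star i j + star j i];
   each of the two sums is at most [t]. *)
pose star i j : R := Num.max 0 (Q j j - 1 - 2 * Q i j).
have star_le : \sum_i \sum_j star i j <= t.
  rewrite exchange_big; apply: ler_sum => j _.
  rewrite /star; under eq_bigr do rewrite Qsym.
  exact: sum_pos_part_column_le.
apply: (@le_trans _ _ (\sum_i \sum_j w' i j +
  \sum_i \sum_j w' i j * Num.min (Q i i) (Q j j) +
  (\sum_i \sum_j star i j + \sum_i \sum_j star j i))); last first.
  by rewrite [X in _ + (_ + X)]exchange_big -/t in min_le *; rewrite expr2; lra.
rewrite -!big_split; apply: ler_sum => i _ /=.
rewrite -!big_split; apply: ler_sum => j _ /=.
pose h := Num.max (Q i i) (Q j j) - 1 - 2 * Q i j.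
have -> : Q i i + Q j j - 2 * Q i j = 1 + Num.min (Q i i) (Q j j) + h.
  by rewrite /h -[Q i i + Q j j]addr_max_min; lra.
rewrite (mulrDr _ _ h) (mulrDr _ 1) mulr1 lerD2l.
apply: (@le_trans _ _ (Num.max 0 h)).
  apply: (@le_trans _ _ (w' i j * Num.max 0 h)).
    by rewrite ler_wpM2l // le_max lexx orbT.
  by rewrite ler_piMl // le_max lexx.
have star_ge0 l m : 0 <= star l m by rewrite /star le_max lexx.
have star_ge l m : Q m m - 1 - 2 * Q l m <= star l m.
  by rewrite /star le_max lexx orbT.
have := star_ge i j; have := star_ge j i; rewrite (Qsym j i).
have := star_ge0 i j; have := star_ge0 j i.
by rewrite ge_max /h; case: (leP (Q i i) (Q j j)) => *; apply/andP; split; lra.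
Qed.

(** * From eigenvalue sums to projectors *)

Lemma char_poly_conj (F : fieldType) n (P D : 'M[F]_n) :
  P \in unitmx -> char_poly (invmx P *m D *m P) = char_poly D.
Proof.
move=> Pu; rewrite /char_poly.
have -> : char_poly_mx (invmx P *m D *m P) =
    map_mx polyC (invmx P) *m char_poly_mx D *m map_mx polyC P.
  rewrite /char_poly_mx mulmxBr mulmxBl -!map_mxM /=; congr (_ - _).
  by rewrite mul_mx_scalar -scalemxAl -map_mxM mulVmx // map_mx1 scalemx1.
by rewrite !det_mulmx mulrAC -det_mulmx -map_mxM mulVmx // map_mx1 det1 mul1r.
Qed.

Local Notation "A ^t*" := (map_mx Num.conj (A^T)) (at level 30).

(** The rows of [W] are orthonormal eigenvectors for the [k] largest eigenvalues, taken from the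
    unitary diagonalization over [R[i]]. *)
Lemma eigenvalue_frame (R : rcfType) n (A : 'M[R]_n) k : A^T = A -> (k <= n)%N ->
  exists W : 'M[R[i]]_(k, n), W *m W^t* = 1%:M /\
    \tr (W *m map_mx (real_complex R) A *m W^t*) =
      (\sum_(1 <= i < k.+1) lambda i A)%:C%C.
Proof.
move=> symA k_le; set toC := real_complex R; set B := map_mx toC A.
have realB : B \is a realmx.
  by apply/mxOverP => i j; rewrite mxE; apply/complex_realP; exists (A i j).
have hermB : B \is hermsymmx.
  apply: realsym_hermsym => //; apply/is_hermitianmxP.
  by rewrite expr0 scale1r map_mx_id // map_trmx symA.
have /orthomx_spectralP defB := hermitian_normalmx hermB.
set P := spectralmx B in defB; set d := spectral_diag B in defB.
have Punit : P \in unitmx by apply: spectral_unit.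
have /unitarymxP PP : P \is unitarymx by apply: spectral_unitarymx.
(* The diagonalization lists the spectrum in an unspecified order; equal characteristic polynomials
   give a permutation [s] to the decreasing one. *)
have perm_d : perm_eq (map toC (eigenvalues A)) [tuple d 0 i | i < n].
  apply: prod_XsubC_eq; rewrite big_map.
  transitivity (map_poly toC (char_poly A)).
    rewrite char_poly_eigenvalues // rmorph_prod /=; apply: eq_bigr => x _.
    by rewrite rmorphB /= map_polyX map_polyC.
  rewrite map_char_poly -/B defB char_poly_conj // char_poly_trig ?diag_mx_is_trig //.
  by rewrite big_tuple; apply: eq_bigr => i _; rewrite tnth_mktuple mxE eqxx.
have /tuple_permP[s eig_s] := perm_d.
have eigE (i : 'I_n) : toC (nth 0 (eigenvalues A) i) = d 0 (s i).
  rewrite -(nth_map 0 0) ?size_eigenvalues // eig_s -tnth_nth.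
  by rewrite !tnth_mktuple.
pose f (i : 'I_k) := s (widen_ord k_le i).
have f_inj : injective f by move=> i j /perm_inj []/val_inj.
have subE (X : 'M[R[i]]_n) :
    rowsub f P *m X *m (rowsub f P)^t* = mxsub f f (P *m X *m P^t*).
  by rewrite trmx_mxsub map_mxsub mul_rowsub_mx -mxsub_mul.
exists (rowsub f P); split.
  rewrite -[X in X *m _]mulmx1 subE mulmx1 PP.
  by apply/matrixP => i j; rewrite !mxE (inj_eq f_inj).
rewrite -/B subE defB invmx_unitary ?spectral_unitarymx // -!mulmxA PP mulmx1.
rewrite mulmxA PP mul1mx big_add1 big_mkord [RHS](raddf_sum (real_complex R)).
by apply: eq_bigr => i _; rewrite !mxE eqxx mulr1n /lambda -eigE.
Qed.

(** The real part of the projector [Pi] need not be idempotent. Since [Pi] is Hermitian and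
    idempotent, row [i] has squared norm [Pi i i]; dropping the imaginary parts leaves an
    inequality. *)
Lemma eigenvalue_projector (R : rcfType) n (A : 'M[R]_n) k :
  A^T = A -> (k <= n)%N ->
  exists Q : 'M[R]_n,
    [/\ forall i j, Q i j = Q j i,
        forall x : 'I_n -> R, 0 <= \sum_i \sum_j x i * x j * Q i j,
        forall i, \sum_j Q i j ^+ 2 <= Q i i,
        \sum_i Q i i = k%:R &
        \sum_i \sum_j Q i j * A j i = \sum_(1 <= i < k.+1) lambda i A].
Proof.
move=> symA k_le; have [W [WW trW]] := eigenvalue_frame symA k_le.
have ReD : {morph @complex.Re R : x y / x + y} by case=> [a b] [c d].
have Re_sum (I : finType) (F : I -> R[i]) :
    complex.Re (\sum_i F i) = \sum_i complex.Re (F i).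
  exact: (big_morph _ ReD).
pose X := map_mx (@complex.Re R) W; pose Z := map_mx (@complex.Im R) W.
pose Pi := W^t* *m W; pose Q := map_mx (@complex.Re R) Pi.
(* [Q] is the sum of the Gram matrices of the columns of [X] and of [Z], hence positive
   semidefinite. *)
have QE i j : Q i j = \sum_l (X l i * X l j + Z l i * Z l j).
  rewrite !mxE Re_sum; apply: eq_bigr => l _; rewrite !mxE.
  by case: (W l i) (W l j) => [a b] [c d] /=; lra.
have PiC i j : Pi j i = (Pi i j)^*%C.
  rewrite !mxE rmorph_sum; apply: eq_bigr => l _; rewrite !mxE rmorphM /=.
  by rewrite conjcK mulrC.
have PiPi : Pi *m Pi = Pi by rewrite /Pi mulmxA -(mulmxA _ W) WW mulmx1.
exists Q; split.
- by move=> i j; rewrite !QE; apply: eq_bigr => l _; lra.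
- move=> x.
  have -> : \sum_i \sum_j x i * x j * Q i j =
      \sum_l ((\sum_i x i * X l i) ^+ 2 + (\sum_i x i * Z l i) ^+ 2).
    under eq_bigr => i _ do under eq_bigr => j _ do rewrite QE mulr_sumr.
    under eq_bigr => i _ do rewrite exchange_big.
    rewrite exchange_big; apply: eq_bigr => l _ /=.
    rewrite !expr2 !mulr_suml -big_split; apply: eq_bigr => i _ /=.
    rewrite !mulr_sumr -big_split; apply: eq_bigr => j _ /=; ring.
  by apply: sumr_ge0 => l _; rewrite addr_ge0 ?sqr_ge0.
- move=> i; rewrite [leRHS]mxE -PiPi mxE Re_sum; apply: ler_sum => j _.
  rewrite (PiC i j) mxE; case: (Pi i j) => a b /=.
  by have := sqr_ge0 b; rewrite !expr2; lra.
- have : complex.Re (\tr Pi) = k%:R.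
    rewrite /Pi mxtrace_mulC WW mxtrace1 -(rmorph_nat (real_complex R)) //.
  by rewrite /mxtrace Re_sum => <-; apply: eq_bigr => i _; rewrite mxE.
rewrite -mxtrace_mulC mulmxA -/Pi in trW.
have -> : \sum_(1 <= i < k.+1) lambda i A =
    complex.Re (\tr (Pi *m map_mx (real_complex R) A)).
  by rewrite trW.
rewrite /mxtrace Re_sum; apply: eq_bigr => i _; rewrite mxE Re_sum.
apply: eq_bigr => j _; rewrite [Q i j]mxE [map_mx _ A j i]mxE.
case: (Pi i j) => a b /=.
by rewrite mulr0 subr0.
Qed.

(** * Edge counts and the Laplacian *)

(** An arc is determined by its edge and by whether [enum_rank] increases along it. *)
Lemma card_arcs_le (V : finType) (e : rel V) :
  irreflexive e -> (\sum_u \sum_v e u v <= 2 * #|edges e|)%N.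
Proof.
move=> e_irr.
have -> : (\sum_u \sum_v e u v = #|[set p : V * V | e p.1 p.2]|)%N.
  rewrite pair_big -sum1_card [RHS]big_mkcond; apply: eq_bigr => p _ /=.
  by rewrite inE; case: (e _ _).
rewrite mulnC -card_bool -cardsT -cardsX.
pose f (p : V * V) := ([set p.1; p.2], (enum_rank p.1 < enum_rank p.2)%N).
have f_inj : {in [set p : V * V | e p.1 p.2] &, injective f}.
  move=> [a b] [c d]; rewrite !inE /= => eab ecd [/setP eqS eq_lt].
  have aNb : a != b by apply: contraTneq eab => ->; rewrite e_irr.
  have : a \in [set c; d] by rewrite -eqS set21.
  have : b \in [set c; d] by rewrite -eqS set22.
  rewrite !inE => /orP[] /eqP bE /orP[] /eqP aE; subst a b;
    rewrite ?eqxx // in aNb *.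
  case: ltngtP eq_lt => // /val_inj/enum_rank_inj dc _.
  by rewrite dc eqxx in aNb.
rewrite -(card_in_imset f_inj); apply: subset_leq_card.
apply/subsetP => _ /imsetP[[u v] uv_in ->]; move: uv_in.
rewrite inE /= => euv; rewrite /f /= !inE andbT.
by apply/imset2P; exists u v.
Qed.

Lemma laplacian_sym (V : finType) (e : rel V) (R : pzRingType) :
  symmetric e -> (laplacian e R)^T = laplacian e R.
Proof.
move=> e_sym; apply/matrixP => i j; rewrite !mxE /= eq_sym e_sym.
by case: eqVneq => // ->.
Qed.

(** This writes [tr (Q L)] as a sum over edges; the 2 accounts for the two orders of each edge. *)
Lemma sum_mul_laplacian (V : finType) (e : rel V) (R : comPzRingType)
    (Q : 'I_#|V| -> 'I_#|V| -> R) :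
  symmetric e -> irreflexive e ->
  2 * (\sum_i \sum_j Q i j * laplacian e R j i) =
    \sum_i \sum_j
      (e (enum_val i) (enum_val j))%:R * (Q i i + Q j j - 2 * Q i j).
Proof.
move=> e_sym e_irr; pose w (i j : 'I_#|V|) : R := (e (enum_val i) (enum_val j))%:R.
have wsym i j : w i j = w j i by rewrite /w e_sym.
have lapE i j : laplacian e R j i = (j == i)%:R * \sum_l w i l - w i j.
  rewrite mxE /= (inj_eq enum_val_inj) /w e_sym.
  have [->|jNi] := eqVneq j i; last first.
    by rewrite mul0r sub0r; case: (e _ _) => //; rewrite oppr0.
  rewrite e_irr subr0 mul1r /degree -sum1_card natr_sum big_mkcond /=.
  rewrite (reindex _ (onW_bij _ (enum_val_bij V))).
  by apply: eq_bigr => l _; rewrite inE; case: (e _ _).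
have diagE : \sum_i \sum_j w i j * Q j j = \sum_i \sum_j w i j * Q i i.
  by rewrite exchange_big; apply: eq_bigr => i _; apply: eq_bigr => j _; rewrite wsym.
transitivity (\sum_i \sum_j w i j * Q i i + \sum_i \sum_j w i j * Q j j
    - 2 * \sum_i \sum_j w i j * Q i j); last first.
  rewrite mulr_sumr -big_split -sumrB; apply: eq_bigr => i _ /=.
  rewrite mulr_sumr -big_split -sumrB; apply: eq_bigr => j _ /=.
  by rewrite -/(w i j); ring.
have double_sub (x y : R) : x + x - 2 * y = 2 * (x - y) by ring.
rewrite diagE double_sub -sumrB; congr (_ * _).
apply: eq_bigr => i _; rewrite -sumrB.
under eq_bigr do rewrite lapE mulrBr mulrCA.
rewrite !sumrB (bigD1 i) //= eqxx mul1r.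
rewrite [X in _ + X - _]big1 ?addr0 => [|j /negPf ->]; last by rewrite mul0r.
by rewrite -mulr_suml mulrC; congr (_ - _); apply: eq_bigr => j _; rewrite mulrC.
Qed.

Lemma sum_lambda_laplacian_le (R : rcfType) (V : finType) (e : rel V) k :
  symmetric e -> irreflexive e -> (k <= #|V|)%N ->
  \sum_(1 <= i < k.+1) lambda i (laplacian e R) <=
    #|edges e|%:R + k%:R ^+ 2 + k%:R.
Proof.
move=> e_sym e_irr k_le.
have [Q [Qsym psd sq_le trQ <-]] := eigenvalue_projector (laplacian_sym R e_sym) k_le.
pose w (i j : 'I_#|V|) : R := (e (enum_val i) (enum_val j))%:R.
have w01 i j : 0 <= w i j <= 1 by rewrite /w; case: (e _ _); rewrite ?lexx ler01.
have := weighted_dist_le w01 Qsym psd sq_le.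
rewrite -sum_mul_laplacian // trQ.
have : \sum_i \sum_j w i j <= 2 * #|edges e|%:R.
  have := card_arcs_le e_irr; rewrite -(ler_nat R) natrM natr_sum.
  rewrite (reindex _ (onW_bij _ (enum_val_bij V))); congr (_ <= _).
  apply: eq_bigr => i _; rewrite natr_sum.
  by rewrite [LHS](reindex _ (onW_bij _ (enum_val_bij V))).
lra.
Qed.

Theorem theorem1p3 (R : realType) (V : finType) (e : rel V)
    (e_sym : symmetric e) (e_irr : irreflexive e) (k : nat)
    (k_gt0 : (1 <= k)%N) (k_le : (k <= #|V|)%N) :
  \sum_(1 <= i < k.+1) lambda i (laplacian e R) <=
    #|edges e|%:R + k%:R ^+ 2 + 15 * k%:R * ln k%:R + 65 * k%:R.
Proof.
(* As [1 <= k], the logarithm is nonnegative, so [k] is at most the last two terms of the bound. *)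
have := sum_lambda_laplacian_le R e_sym e_irr k_le.
have ln_k : 0 <= k%:R * ln k%:R :> R by rewrite mulr_ge0 // ln_ge0 // ler1n.
have : 0 <= k%:R :> R by [].
by move: ln_k; lra.
Qed.
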